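(* Let $\{q_1, q_2, \ldots, q_k\}$ be a pinnacle set of a graph $G$ with $q_1 < q_2 < \cdots < q_k$. If $G$ is connected, then $\{q_i, q_{i+1}, \ldots, q_k\}$ is also a pinnacle set of $G$ for each $i = 2, 3, \ldots, k$.
   Context: Graphs are finite and simple, and $[n] = \{1,2,\ldots,n\}$. A labeling of a graph $G$ with $n$ vertices is a bijection $\lambda : V(G) \to [n]$. The label $\lambda(u)$ of a vertex $u$ is a pinnacle of $(G,\lambda)$ if $\lambda(u) > \lambda(v)$ for every neighbor $v$ of $u$ (so the label of an isolated vertex is vacuously a pinnacle). The pinnacle set of $(G,\lambda)$ is the set of all pinnacles of $(G,\lambda)$. A subset $S \subseteq [n]$ is a pinnacle set of $G$ if there is a labeling $\lambda$ of $G$ such that $S$ is the pinnacle set of $(G,\lambda)$. *)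

(* Defs.v *)
From mathcomp Require Import all_boot.

Set Implicit Arguments.
Unset Strict Implicit.
Unset Printing Implicit Defensive.

(* A finite simple graph is a symmetric irreflexive adjacency relation
   e : rel T on a finType T of vertices. *)
Definition simple_graph (T : finType) (e : rel T) : Prop :=
  symmetric e /\ irreflexive e.

Definition connected_graph (T : finType) (e : rel T) : Prop :=
  forall x y : T, connect e x y.

(* Labels are the natural numbers 1, ..., #|T|: a bijection from T to [#|T|]
   is an injective lam : T -> nat whose image is exactly that interval. *)
Definition labeling (T : finType) (lam : T -> nat) : Prop :=
  injective lam /\ codom lam =i [pred m | 1 <= m <= #|T|].

Definition pinnacle_vertex (T : finType) (e : rel T) (lam : T -> nat) (u : T) :
    bool :=
  [forall v, e u v ==> (lam v < lam u)].

Definition pinnacles (T : finType) (e : rel T) (lam : T -> nat) : {pred nat} :=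
  [pred m | [exists u, (lam u == m) && pinnacle_vertex e lam u]].

(* S is included in [#|T|] automatically, since every pinnacle is a label. *)
Definition is_pinnacle_set (T : finType) (e : rel T) (S : {pred nat}) : Prop :=
  exists lam : T -> nat, labeling lam /\ S =i pinnacles e lam.

(* Main.v *)
Require Import Defs.
From mathcomp Require Import all_boot perm.

(** Put c = q_{i-1} and keep every label above c where it is.  The vertices
    carrying the labels 1, ..., c can be relabelled so that none of them is a
    pinnacle: hand out c, c - 1, ..., 1 in this order, each time to a vertex
    adjacent to one that already has its label.  Such a vertex exists because
    the graph is connected and c is not the largest label
    ([crossing_edge]).  Each of these vertices then has a neighbor with a
    larger label.  A vertex with label above c keeps its status, since every
    neighbor either keeps its label or stays at or below c.  Hence the new
    pinnacles are exactly the old ones above c ([pinnacles_above]), namely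
    q_i, ..., q_k.

    The relabelling is carried out by successive transpositions
    ([relabel_below]), so that at every stage the current function is a labeling
    of the whole graph. *)

Section Relabelling.

Variables (T : finType) (e : rel T).

Lemma crossing_edge (a : pred T) (x y : T) :
  symmetric e -> connect e x y -> a x -> ~~ a y ->
  exists u v, [/\ e u v, a u & ~~ a v].
Proof.
move=> sym_e xy ax nay.
have [/existsP[u /existsP[v /and3P[]]]|none] :=
  boolP [exists u, exists v, [&& e u v, a u & ~~ a v]]; first by exists u, v.
have cl_a : closed e a.
  apply: (intro_closed (sym_connect_sym sym_e)) => u v uv au.
  apply: contraNT none => nav.
  by apply/existsP; exists u; apply/existsP; exists v; apply/and3P.
by move: nay; have /= := closed_connect cl_a xy; rewrite /in_mem /= ax => <-.
Qed.

Section Labeling.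

Variable lam : T -> nat.
Hypothesis lam_lab : labeling lam.

Lemma label_bounds x : 1 <= lam x <= #|T|.
Proof. by have := lam_lab.2 (lam x); rewrite codom_f inE => <-. Qed.

Lemma label_onto m : 1 <= m <= #|T| -> exists x, lam x = m.
Proof.
by move=> m_ok; have := lam_lab.2 m; rewrite inE m_ok => /codomP[x ->]; exists x.
Qed.

Lemma labeling_perm (s : {perm T}) : labeling (lam \o s).
Proof.
split=> [|m]; first exact: inj_comp lam_lab.1 perm_inj.
rewrite -lam_lab.2; apply/codomP/codomP => -[x ->]; first by exists (s x).
by exists (s^-1 x)%g; rewrite /= permKV.
Qed.

End Labeling.

(** The relabelled function agrees with [lam] above [c] and is at most [c]
    wherever [lam] is; comparing the values truncated from below at [c] says
    both at once.  The parameter [d] counts the labels c, c - 1, ... that have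
    been handed out so far: the step places the label j = c - d at a vertex
    across an edge from those labelled above j, by exchange with its present
    owner. *)
Lemma relabel_below (lam : T -> nat) (c d : nat) :
  symmetric e -> connected_graph e -> labeling lam -> c < #|T| -> d <= c ->
  exists mu, [/\ labeling mu, forall v, maxn c (mu v) = maxn c (lam v)
    & forall v, c - d < mu v <= c -> exists2 u, e v u & mu v < mu u].
Proof.
move=> sym_e conn_e lam_lab ltcT; elim: d => [_|d IHd ltdc].
  exists lam; split=> // v; rewrite subn0 => /andP[lt le].
  by rewrite leqNgt lt in le.
have [mu [mu_lab mu_max mu_up]] := IHd (ltnW ltdc).
set j := c - d in mu_up; have jS : (c - d.+1).+1 = j by rewrite -subSn.
have j_gt0 : 0 < j by rewrite subn_gt0.
have le_jc : j <= c := leq_subr _ _.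
have [w wj] : exists w, mu w = j.
  by apply: label_onto => //; rewrite j_gt0 (leq_trans le_jc) // ltnW.
have [z zT] : exists z, mu z = #|T|.
  by apply: label_onto => //; rewrite leqnn (leq_ltn_trans _ ltcT).
have [||u [v [uv uj /=]]] :=
  crossing_edge (fun x => j < mu x) z w sym_e (conn_e z w).
- by rewrite zT (leq_ltn_trans le_jc).
- by rewrite wj ltnn.
rewrite -leqNgt => vj.
(* Exchanging the labels of v and w moves only labels that are at most j. *)
pose nu := mu \o tperm v w.
have nu_gt x : j < mu x -> nu x = mu x.
  move=> jx; rewrite /nu /= tpermD //; apply: contraTneq jx => <-.
    by rewrite -leqNgt.
  by rewrite wj ltnn.
have nu_le x : mu x <= j -> nu x <= j.
  by rewrite /nu /=; case: tpermP => // -> _; rewrite ?wj.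
have nu_lab : labeling nu by exact: labeling_perm.
exists nu; split=> // [x|x].
  rewrite -mu_max; case: (leqP (mu x) j) => [xj|/nu_gt-> //].
  by rewrite !(maxn_idPl _) // (leq_trans _ le_jc) // nu_le.
rewrite jS leq_eqVlt => /andP[/orP[/eqP jx _|jx xc]].
  (* The vertex with new label j is v, whose neighbor u lies above j. *)
  have -> : x = v by apply: nu_lab.1; rewrite -jx /nu /= tpermL.
  by exists u; rewrite 1?sym_e // (nu_gt u) // /nu /= tpermL wj.
have xE : nu x = mu x.
  by apply: nu_gt; rewrite ltnNge; apply: contraL jx => /nu_le; rewrite -leqNgt.
rewrite xE in jx xc *.
have [|y xy lt_xy] := mu_up x; first by rewrite jx.
by exists y => //; rewrite nu_gt // (ltn_trans jx).
Qed.

(** The labeling obtained from [relabel_below] at [d = c] has no pinnacle among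
    1, ..., c, and truncation at [c] cannot change whether a label above [c]
    dominates those of the neighbors. *)
Lemma pinnacles_above (lam : T -> nat) (c : nat) :
  symmetric e -> connected_graph e -> labeling lam -> c < #|T| ->
  is_pinnacle_set e [pred m | (c < m) && (m \in pinnacles e lam)].
Proof.
move=> sym_e conn_e lam_lab ltcT.
have [mu [mu_lab mu_max]] :=
  relabel_below lam c c sym_e conn_e lam_lab ltcT (leqnn c).
rewrite subnn => mu_up; exists mu; split=> // m.
have lt_max (f : T -> nat) v : c < m -> (f v < m) = (maxn c (f v) < m).
  by move=> cm; rewrite gtn_max cm.
(* Since the values truncated at c agree, the two labelings compare in the same
   way with every m above c. *)
have eq_lt v : c < m -> (mu v < m) = (lam v < m).
  by move=> cm; rewrite (lt_max mu) // (lt_max lam) // mu_max.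
have eq_val v : c < m -> (mu v == m) = (lam v == m).
  move=> cm; have eq_max (f : T -> nat) : (f v == m) = (maxn c (f v) == m).
    rewrite /maxn; case: ltnP => // fc.
    by rewrite (ltn_eqF cm) ltn_eqF // (leq_ltn_trans fc).
  by rewrite eq_max mu_max -eq_max.
rewrite !inE; case: (ltnP c m) => [cm|mc] /=.
  apply: eq_existsb => v; rewrite eq_val //.
  case: eqP => //= vm; apply: eq_forallb => w.
  have /eqP -> : mu v == m by rewrite eq_val // vm.
  by rewrite vm eq_lt.
apply/esym/existsP => -[v /andP[/eqP vm /forallP pv]].
have [|u vu] := mu_up v.
  by rewrite vm mc -vm; case/andP: (label_bounds mu mu_lab v) => ->.
by rewrite ltnNge ltnW //; move: (pv u); rewrite vu.
Qed.

End Relabelling.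

Theorem theorem4p10 (T : finType) (e : rel T) (k : nat) (q : nat -> nat)
    (hG : simple_graph e)
    (hq : forall a b : nat, 1 <= a -> a < b -> b <= k -> q a < q b)
    (hS : is_pinnacle_set e [in [seq q j | j <- index_iota 1 k.+1]])
    (hconn : connected_graph e) :
  forall i : nat, 2 <= i <= k ->
    is_pinnacle_set e [in [seq q j | j <- index_iota i k.+1]].
Proof.
case=> [|i] // /andP[i_gt0 lt_ik]; have [lam [lam_lab lamS]] := hS.
have k_gt0 : 0 < k by apply: leq_trans lt_ik.
have ltqT : q i < #|T|.
  have : q k \in pinnacles e lam.
    by rewrite -lamS; apply: map_f; rewrite mem_index_iota k_gt0 ltnSn.
  rewrite inE => /existsP[u /andP[/eqP uk _]].
  apply: leq_trans (hq i k i_gt0 lt_ik (leqnn k)) _.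
  by rewrite -uk; case/andP: (label_bounds T lam lam_lab u).
have [mu [mu_lab muS]] :=
  pinnacles_above T e lam (q i) hG.1 hconn lam_lab ltqT.
exists mu; split=> // m.
have -> : (m \in pinnacles e mu) = (q i < m) && (m \in pinnacles e lam).
  by rewrite -muS.
rewrite -lamS.
apply/mapP/andP=> [[j]|[lt_m /mapP[j]]]; rewrite mem_index_iota ltnS.
  case/andP=> lt_ij le_jk ->; split; first exact: hq.
  by apply: map_f; rewrite mem_index_iota ltnS le_jk (leq_trans _ lt_ij).
case/andP=> j_gt0 le_jk mE; exists j; rewrite // mem_index_iota ltnS le_jk andbT.
rewrite ltnNge; apply: contraL lt_m; rewrite mE -leqNgt leq_eqVlt.
by case/orP=> [/eqP-> //|lt_ji]; rewrite ltnW // hq // ltnW.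
Qed.
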